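(* \begin{equation*} \Gamma_{i}^{\left[\substack{s\\ s}\right]\times k} = \begin{cases} 1 & \text{if } i=0,\ k\geq 1,\\ 21\cdot 2^{3i-4} - 3\cdot 2^{2i-3} & \text{if } 1\leq i\leq s-1,\ k>i,\\ 3\cdot 2^{k+s-1} + 21\cdot 2^{3s-4} - 27\cdot 2^{2s-3} & \text{if } i=s,\ k>s,\\ 21\cdot\left[2^{k-2s+3i-4} + 2^{3i-4} - 5\cdot 2^{4i-2s-5}\right] & \text{if } s+1\leq i\leq 2s-1,\ k>i,\\ 2^{2k+2s-2} - 3\cdot 2^{k+4s-4} + 2^{6s-5} & \text{if } i=2s,\ k>2s. \end{cases} \end{equation*}
   Context: $\Gamma_{i}^{\left[\substack{s\\ s}\right]\times k}$ denotes the number of rank $i$ matrices over $\mathbb{F}_2$ of the form $\left[\frac{A}{B}\right]$ where $A$ and $B$ are both $s\times k$ persymmetric matrices over $\mathbb{F}_2$ (a matrix $[\alpha_{i,j}]$ is persymmetric if $\alpha_{i,j}=\alpha_{r,s}$ whenever $i+j=r+s$). *)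

(* Defs.v *)
From mathcomp Require Import all_boot all_order all_algebra.

Set Implicit Arguments.
Unset Strict Implicit.
Unset Printing Implicit Defensive.

Local Open Scope ring_scope.

(* Indices start at 0 instead of 1; the condition i + j = p + q is invariant
   under this shift. *)
Definition persymmetric (T : eqType) (m n : nat) (A : 'M[T]_(m, n)) : bool :=
  [forall i : 'I_m, forall j : 'I_n, forall p : 'I_m, forall q : 'I_n,
     (i + j == p + q)%N ==> (A i j == A p q)].

Definition Gamma (i s k : nat) : nat :=
  #|[set M : 'M['F_2]_(s + s, k) |
      [exists A : 'M['F_2]_(s, k), exists B : 'M['F_2]_(s, k),
         [&& persymmetric A, persymmetric B & M == col_mx A B]]
      && (\rank M == i)]|.

(* Main.v *)
Require Import Defs.
From HB Require Import structures.
From mathcomp Require Import all_boot all_order all_algebra.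
From mathcomp Require Import mxabelem zify ring lra.

Set Implicit Arguments.
Unset Strict Implicit.
Unset Printing Implicit Defensive.
Import Order.TTheory GRing.Theory Num.Theory.
Local Open Scope ring_scope.

(** Two [s x k] persymmetric blocks are the Hankel matrices of two sequences of
    length [s + k - 1], read as functionals on polynomials.  The right kernel
    [K(s, k)] of the stacked matrix is then a space of polynomials of degree
    less than [k], and the same two sequences also give a stacked matrix with
    [s + 1] and [k - 1] in place of [s] and [k].  Since [K(s, k + 1)] contains
    [K(s + 1, k) + 'X K(s + 1, k)], and similarly for left kernels, the ranks
    for [(s + 1, k)] and [(s, k + 1)] are equal or differ by one (apart from
    full rank).  They are both equal to [j] exactly when [K(s, k + 1)] consists
    of the multiples of one polynomial [f] of degree at most [j].  Pulling the
    functionals back along multiplication by a polynomial coprime to [f] shows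
    that the number of such pairs does not depend on [k], and for [k = j] it is
    the number of pairs for which the [2s x (j + 1)] matrix has rank [j].  This
    yields a recursion on [s] for the number of pairs of given rank.  The two
    largest ranks, which the recursion does not reach, follow from the total
    number of pairs and the average size of the right kernel. *)

(** * The field with two elements, and row vectors read as polynomials *)

Definition F2 : finFieldType := 'F_2.
Arguments F2 : simpl never.
Local Notation F := F2.

Lemma card_F2 : #|F| = 2%N.
Proof. exact: card_Fp. Qed.

Lemma F2_neq0 (x : F) : x != 0 -> x = 1.
Proof. by case: x => [[|[|m]]] // lm _; apply/val_inj. Qed.

Lemma card_F2_rV n : #|{: 'rV[F]_n}| = (2 ^ n)%N.
Proof. by rewrite card_mx card_F2 mul1n. Qed.

(** Ranks are read off from cardinalities of kernels, so comparing two ranks becomes comparing the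
    sizes of two finite sets. *)
Lemma card_mulmx_eq0 m n (A : 'M[F]_(m, n)) :
  #|[set v : 'rV_m | v *m A == 0]| = (2 ^ (m - \rank A))%N.
Proof.
have := card_rowg (kermx A); rewrite card_F2 mxrank_ker => <-.
apply: eq_card => v; rewrite inE mem_rowg.
by apply/eqP/sub_kermxP.
Qed.

Lemma size_rVpoly n (v : 'rV[F]_n) : (size (rVpoly v) <= n)%N.
Proof. exact: size_poly. Qed.

Lemma rVpoly_inj n : injective (@rVpoly F n).
Proof. exact: can_inj rVpolyK. Qed.

Lemma rVpoly_eq0 n (v : 'rV[F]_n) : (rVpoly v == 0) = (v == 0).
Proof. by rewrite -(inj_eq (@rVpoly_inj n)) linear0. Qed.

(** * Sequences as functionals on polynomials *)

(** Coefficients of [p] of index [n] or more are ignored; this is why size bounds accompany the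
    statements below. *)
Definition pairing n (a : 'rV[F]_n) (p : {poly F}) : F :=
  \sum_(j < n) a 0 j * p`_j.

Fact pairing_is_scalar n (a : 'rV[F]_n) : scalar (pairing a).
Proof.
move=> c p q; rewrite /pairing mulr_sumr -big_split /=.
by apply: eq_bigr => j _; rewrite coefD coefZ mulrDr mulrCA.
Qed.

HB.instance Definition _ n (a : 'rV[F]_n) :=
  GRing.isLinear.Build F {poly F} F _ (pairing a) (@pairing_is_scalar n a).

Lemma pairingD n (a : 'rV[F]_n) p q :
  pairing a (p + q) = pairing a p + pairing a q.
Proof. exact: linearD. Qed.

Lemma pairingBl n (a b : 'rV[F]_n) p :
  pairing (a - b) p = pairing a p - pairing b p.
Proof.
rewrite /pairing -sumrB; apply: eq_bigr => j _.
by rewrite !mxE mulrBl.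
Qed.

Lemma pairingXn n (a : 'rV[F]_n) (j : 'I_n) : pairing a 'X^j = a 0 j.
Proof.
rewrite /pairing (bigD1 j) //= coefXn eqxx mulr1 big1 ?addr0 // => i ne.
by rewrite coefXn -val_eqE in ne *; rewrite (negPf ne) mulr0.
Qed.

Lemma pairing_eq0 n (a : 'rV[F]_n) :
  (forall p : {poly F}, (size p <= n)%N -> pairing a p = 0) -> a = 0.
Proof.
move=> a0; apply/rowP => j; rewrite mxE -pairingXn.
by apply: a0; rewrite size_polyXn.
Qed.

Lemma pairing_mul n (a : 'rV[F]_n) s (u v : {poly F}) : (size u <= s)%N ->
  pairing a (u * v) = \sum_(i < s) u`_i * pairing a ('X^i * v).
Proof.
move=> /poly_rV_K <-; rewrite [in LHS]/rVpoly poly_def mulr_suml linear_sum.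
apply: eq_bigr => i _; rewrite -scalerAl linearZ /=; congr (_ * _).
by rewrite coef_poly ltn_ord.
Qed.

(** The length [n] is independent of the shape, so the same sequence can be read in several shapes.
    It fits the shape exactly when [s + k = n.+1]; in particular length [s + k] fits both
    [(s.+1, k)] and [(s, k.+1)]. *)
Definition hankel s k n (a : 'rV[F]_n) : 'M[F]_(s, k) :=
  \matrix_(i, j) pairing a 'X^(i + j).

Definition hankel2 s k n (ab : 'rV[F]_n * 'rV[F]_n) : 'M[F]_(s + s, k) :=
  col_mx (hankel s k ab.1) (hankel s k ab.2).

Lemma hankel_mul_tr s k n (a : 'rV[F]_n) (v : 'rV[F]_k) i :
  (hankel s k a *m v^T) i 0 = pairing a ('X^i * rVpoly v).
Proof.
rewrite mulrC (pairing_mul _ _ (size_rVpoly v)) mxE; apply: eq_bigr => j _.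
by rewrite !mxE coef_rVpoly_ord exprD mulrC ['X^i * _]mulrC.
Qed.

Lemma mul_hankel s k n (a : 'rV[F]_n) (u : 'rV[F]_s) j :
  (u *m hankel s k a) 0 j = pairing a ('X^j * rVpoly u).
Proof.
rewrite mulrC (pairing_mul _ _ (size_rVpoly u)) mxE; apply: eq_bigr => i _.
by rewrite !mxE coef_rVpoly_ord exprD.
Qed.

(** * The two kernels of a stacked Hankel matrix *)

(** A predicate on polynomials rather than vectors, so that kernels for different numbers of columns
    can be compared; [Rker] adds the degree bound. *)
Definition right_ker s n (ab : 'rV[F]_n * 'rV[F]_n) (v : {poly F}) : bool :=
  [forall i : 'I_s, (pairing ab.1 ('X^i * v) == 0)
                 && (pairing ab.2 ('X^i * v) == 0)].

Lemma rkerP s n (ab : 'rV[F]_n * 'rV[F]_n) v :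
  reflect (forall u : {poly F}, (size u <= s)%N ->
             pairing ab.1 (u * v) = 0 /\ pairing ab.2 (u * v) = 0)
          (right_ker s ab v).
Proof.
apply: (iffP forallP) => [kv u su | kv i].
  by split; rewrite (pairing_mul _ _ su) big1 // => i _;
    have /andP[/eqP e1 /eqP e2] := kv i; rewrite ?e1 ?e2 mulr0.
have [|-> ->] := kv 'X^i; last by rewrite eqxx.
by rewrite size_polyXn.
Qed.

Definition left_ker k n (ab : 'rV[F]_n * 'rV[F]_n) (u v : {poly F}) : bool :=
  [forall j : 'I_k, pairing ab.1 ('X^j * u) + pairing ab.2 ('X^j * v) == 0].

Definition Rker s k n (ab : 'rV[F]_n * 'rV[F]_n) : {set 'rV[F]_k} :=
  [set v | right_ker s ab (rVpoly v)].

Definition Lker s k n (ab : 'rV[F]_n * 'rV[F]_n) : {set 'rV[F]_(s + s)} :=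
  [set w | left_ker k ab (rVpoly (lsubmx w)) (rVpoly (rsubmx w))].

Lemma card_Rker s k n (ab : 'rV[F]_n * 'rV[F]_n) :
  #|Rker s k ab| = (2 ^ (k - \rank (hankel2 s k ab)))%N.
Proof.
rewrite -mxrank_tr -card_mulmx_eq0; apply: eq_card => v; rewrite !inE.
rewrite -trmx_eq0 trmx_mul trmxK mul_col_mx col_mx_eq0.
apply/forallP/andP => [kv | [/eqP e1 /eqP e2] i].
  by split; apply/eqP/matrixP => i j; rewrite ord1 hankel_mul_tr mxE;
    have /andP[/eqP e1 /eqP e2] := kv i.
by rewrite -!hankel_mul_tr e1 e2 mxE eqxx.
Qed.

Lemma card_Lker s k n (ab : 'rV[F]_n * 'rV[F]_n) :
  #|Lker s k ab| = (2 ^ (s + s - \rank (hankel2 s k ab)))%N.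
Proof.
rewrite -card_mulmx_eq0; apply: eq_card => w; rewrite !inE.
rewrite -[in RHS](hsubmxK w) mul_row_col.
apply/forallP/eqP => [kw | e j].
  by apply/rowP => j; rewrite mxE !mul_hankel mxE; apply/eqP/kw.
by have := congr1 (fun M : 'rV_k => M 0 j) e; rewrite mxE !mul_hankel mxE => ->.
Qed.

Lemma rkerD s n (ab : 'rV[F]_n * 'rV[F]_n) u v :
  right_ker s ab u -> right_ker s ab v -> right_ker s ab (u + v).
Proof.
move=> /rkerP ku /rkerP kv; apply/rkerP => w sw.
by rewrite mulrDr !linearD /=; have [-> ->] := ku w sw; have [-> ->] := kv w sw;
  rewrite addr0.
Qed.

Lemma rkerB s n (ab : 'rV[F]_n * 'rV[F]_n) u v :
  right_ker s ab u -> right_ker s ab v -> right_ker s ab (u - v).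
Proof.
move=> /rkerP ku /rkerP kv; apply/rkerP => w sw.
by rewrite mulrBr !linearB /=; have [-> ->] := ku w sw; have [-> ->] := kv w sw;
  rewrite subrr.
Qed.

Lemma rker0 s n (ab : 'rV[F]_n * 'rV[F]_n) : right_ker s ab 0.
Proof. by apply/rkerP => w sw; rewrite mulr0 !linear0. Qed.

Lemma lkerD k n (ab : 'rV[F]_n * 'rV[F]_n) u v u' v' :
  left_ker k ab u v -> left_ker k ab u' v' -> left_ker k ab (u + u') (v + v').
Proof.
move=> /forallP k1 /forallP k2; apply/forallP => j.
by rewrite !mulrDr !linearD /= addrACA (eqP (k1 j)) (eqP (k2 j)) addr0.
Qed.

Lemma lkerB k n (ab : 'rV[F]_n * 'rV[F]_n) u v u' v' :
  left_ker k ab u v -> left_ker k ab u' v' -> left_ker k ab (u - u') (v - v').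
Proof.
move=> /forallP k1 /forallP k2; apply/forallP => j.
rewrite !mulrBr !linearB /= addrACA -opprD.
by rewrite (eqP (k1 j)) (eqP (k2 j)) subrr.
Qed.

(** The exponents [0..s] are covered by [0..s-1] and their shift by one. For [s = 0] the right-hand
    side would be vacuous while the left one is not. *)
Lemma rkerS s n (ab : 'rV[F]_n * 'rV[F]_n) v : (0 < s)%N ->
  right_ker s.+1 ab v = right_ker s ab v && right_ker s ab ('X * v).
Proof.
move=> s0; apply/forallP/andP => [kv | [/forallP k1 /forallP k2] [[|i] li]].
- split; apply/forallP => i; first exact: (kv (widen_ord (leqnSn s) i)).
  by have := kv (lift ord0 i); rewrite /= /bump /= add1n exprSr -mulrA.
- exact: (k1 (Ordinal s0)).
- by have := k2 (Ordinal (li : i < s)%N); rewrite /= exprSr -mulrA.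
Qed.

Lemma rkerS_sub s n (ab : 'rV[F]_n * 'rV[F]_n) v :
  right_ker s.+1 ab v -> right_ker s ab v /\ right_ker s ab ('X * v).
Proof.
case: s => [|s]; last by rewrite rkerS // => /andP.
by split; apply/forallP => -[].
Qed.

Lemma lkerS_sub k n (ab : 'rV[F]_n * 'rV[F]_n) u v :
  left_ker k.+1 ab u v -> left_ker k ab u v /\ left_ker k ab ('X * u) ('X * v).
Proof.
move=> /forallP kv; split; apply/forallP => i.
  exact: (kv (widen_ord (leqnSn k) i)).
by have := kv (lift ord0 i); rewrite /= /bump /= add1n exprSr -!mulrA.
Qed.

(** * Comparing the kernels, and hence the ranks, of the two neighbouring shapes *)

Lemma card_double (U V : finZmodType) (f : U -> V) (A : {set U}) (B : {set V}) z :
    injective f -> {morph f : x y / x - y} ->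
    {in A &, forall x y, x - y \in A} ->
    {in A, forall x, f x \in B} -> {in A, forall x, z + f x \in B} ->
    {in A, forall x, f x != z} ->
  (2 * #|A| <= #|B|)%N /\
  (#|B| = (2 * #|A|)%N ->
   {in B, forall y, exists2 x, x \in A & y = f x \/ y = z + f x}).
Proof.
move=> f_inj fB AB sAB szAB nz.
pose C := f @: A :|: (fun x => z + f x) @: A.
have sCB : C \subset B.
  by apply/subsetP => y /setUP[] /imsetP[x xA ->]; [apply: sAB | apply: szAB].
have cC : #|C| = (2 * #|A|)%N.
  rewrite cardsU !card_imset //; last by move=> x y /addrI /f_inj.
  rewrite (_ : _ :&: _ = set0) ?cards0 ?subn0 ?mul2n ?addnn //.
  (* The two copies of [A] are disjoint: [f x = z + f x'] would give [z = f (x - x')] with [x - x']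
     in [A]. *)
  apply/eqP; rewrite -subset0; apply/subsetP => y /setIP[/imsetP[x xA ->]].
  case/imsetP => x' x'A /eqP; rewrite -subr_eq -fB.
  by rewrite (negPf (nz _ (AB _ _ xA x'A))).
split=> [|cB y]; first by rewrite -cC subset_leq_card.
have /eqP <- : C == B by rewrite eqEcard sCB cB cC leqnn.
by case/setUP => /imsetP[x xA ->]; exists x => //; [left | right].
Qed.

Lemma size_XM (p : {poly F}) : p != 0 -> size ('X * p) = (size p).+1.
Proof. by move=> p0; rewrite mulrC size_mulX. Qed.

Lemma size_XM_le (p : {poly F}) k : (size p <= k)%N -> (size ('X * p)%R <= k.+1)%N.
Proof.
by have [->|p0] := eqVneq p 0; rewrite ?mulr0 ?size_poly0 // size_XM.
Qed.

Lemma poly_rV_widen_inj k l : (k <= l)%N ->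
  injective (fun v : 'rV[F]_k => poly_rV (rVpoly v) : 'rV[F]_l).
Proof.
move=> kl x y /(congr1 rVpoly).
by rewrite !poly_rV_K ?(leq_trans (size_rVpoly _)) // => /rVpoly_inj.
Qed.

(** Doubling with [z = 'X * t], where [t] has the largest size in the smaller kernel: [z] is then
    too long to lie in the embedded copy of that kernel. *)
Lemma Rker_double s k n (ab : 'rV[F]_n * 'rV[F]_n) (t : 'rV[F]_k) :
    t != 0 -> t \in Rker s.+1 k ab ->
    {in Rker s.+1 k ab, forall v, size (rVpoly v) <= size (rVpoly t)}%N ->
  (2 * #|Rker s.+1 k ab| <= #|Rker s k.+1 ab|)%N /\
  (#|Rker s k.+1 ab| = (2 * #|Rker s.+1 k ab|)%N ->
   forall y : {poly F}, (size y <= k.+1)%N -> right_ker s ab y ->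
     exists2 x : {poly F}, (size x <= k)%N && right_ker s.+1 ab x & y = x \/ y = 'X * rVpoly t + x).
Proof.
move=> t0 tK tmax.
have t0' : rVpoly t != 0 by rewrite rVpoly_eq0.
have sXt : (size ('X * rVpoly t)%R <= k.+1)%N by rewrite size_XM_le ?size_rVpoly.
have szw (x : 'rV[F]_k) : (size (rVpoly x) <= k.+1)%N.
  exact: leqW (size_rVpoly x).
have [|||||| le2 eq2] := @card_double _ _ (fun v : 'rV[F]_k => poly_rV (rVpoly v))
  (Rker s.+1 k ab) (Rker s k.+1 ab) (poly_rV ('X * rVpoly t)).
- exact: poly_rV_widen_inj.
- by move=> x y; rewrite !linearB.
- by move=> x y; rewrite !inE linearB; apply: rkerB.
- by move=> x; rewrite !inE poly_rV_K // => /rkerS_sub[].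
- move=> x; move: tK; rewrite !inE -linearD poly_rV_K; last first.
    by rewrite (leq_trans (size_polyD _ _)) // geq_max sXt szw.
  move=> /rkerS_sub[_ kt] /rkerS_sub[kx _].
  exact: rkerD.
- move=> x xK; apply: contraTneq isT => /(congr1 rVpoly); rewrite !poly_rV_K // => e.
  by have := tmax x xK; rewrite e size_XM // ltnn.
split=> // e y sy ky; have [|x xK yE] := eq2 e (poly_rV y).
  by rewrite inE poly_rV_K.
exists (rVpoly x); first by rewrite size_rVpoly; move: xK; rewrite inE.
by case: yE => /(congr1 rVpoly); rewrite ?linearD /= !poly_rV_K //; [left | right].
Qed.

Lemma rank_hankel2_leqr s k n (ab : 'rV[F]_n * 'rV[F]_n) :
  (\rank (hankel2 s k ab) <= k)%N.
Proof. exact: rank_leq_col. Qed.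

Lemma rank_hankel2_leql s k n (ab : 'rV[F]_n * 'rV[F]_n) :
  (\rank (hankel2 s k ab) <= s + s)%N.
Proof. exact: rank_leq_row. Qed.

Lemma Rker_max s k n (ab : 'rV[F]_n * 'rV[F]_n) :
    (\rank (hankel2 s k ab) < k)%N ->
  exists t : 'rV[F]_k, [/\ t != 0, t \in Rker s k ab &
    {in Rker s k ab, forall v, size (rVpoly v) <= size (rVpoly t)}%N].
Proof.
move=> rk; have z0 : 0 \in Rker s k ab by rewrite inE linear0 rker0.
have : (0 < #|Rker s k ab :\ 0%R|)%N.
  have := cardsD1 0%R (Rker s k ab); rewrite card_Rker z0 -(subnSK rk) expnS.
  by move: #|_| (expn_gt0 2 (k - (\rank (hankel2 s k ab)).+1)); lia.
case/card_gt0P => v; rewrite in_setD1 => /andP[v0 vK].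
case: (@arg_maxnP _ v [in Rker s k ab] (fun v => size (rVpoly v)) vK) => t tK tmax.
exists t; split=> //; apply: contraNneq v0 => t0.
have := tmax v vK; rewrite /= t0 linear0 size_poly0 leqn0 size_poly_eq0.
by rewrite rVpoly_eq0.
Qed.

Lemma rank_hankel2_ge s k n (ab : 'rV[F]_n * 'rV[F]_n) :
    (\rank (hankel2 s.+1 k ab) < k)%N ->
  (\rank (hankel2 s k.+1 ab) <= \rank (hankel2 s.+1 k ab))%N.
Proof.
move=> rk; have [t [t0 tK tmax]] := Rker_max rk.
have [+ _] := Rker_double t0 tK tmax; rewrite !card_Rker -expnS leq_exp2l //.
by have := rank_hankel2_leqr s k.+1 ab; move: rk; lia.
Qed.

(** The mirror image of the inequality in [Rker_double]. The size of a pair of polynomials is the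
    larger of the two sizes, and [t] maximizes it. *)
Lemma Lker_double s k n (ab : 'rV[F]_n * 'rV[F]_n) :
    (\rank (hankel2 s k.+1 ab) < s + s)%N ->
  (2 * #|Lker s k.+1 ab| <= #|Lker s.+1 k ab|)%N.
Proof.
set A := Lker s k.+1 ab; set B := Lker s.+1 k ab => rs.
have z0 : 0 \in A by rewrite inE !linear0; apply/forallP => j; rewrite mulr0 !linear0 addr0.
have : (0 < #|A :\ 0%R|)%N.
  have := cardsD1 0%R A; rewrite card_Lker z0 -(subnSK rs) expnS.
  by move: #|_| (expn_gt0 2 (s + s - (\rank (hankel2 s k.+1 ab)).+1)); lia.
case/card_gt0P => v; rewrite in_setD1 => /andP[v0 vA].
pose mu m (w : 'rV[F]_(m + m)) := maxn (size (rVpoly (lsubmx w))) (size (rVpoly (rsubmx w))).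
case: (@arg_maxnP _ v [in A] (@mu s) vA) => t tA tmax.
have mu0 w : (mu s w == 0%N) = (w == 0).
  rewrite -leqn0 geq_max !leqn0 !size_poly_eq0 !rVpoly_eq0.
  by rewrite -[w in RHS]hsubmxK row_mx_eq0.
have t0 : t != 0.
  by apply: contraNneq v0 => t0; have := tmax v vA; rewrite /= t0 (eqP (etrans (mu0 0) (eqxx 0))) leqn0 mu0.
pose f (w : 'rV[F]_(s + s)) : 'rV[F]_(s.+1 + s.+1) :=
  row_mx (poly_rV (rVpoly (lsubmx w))) (poly_rV (rVpoly (rsubmx w))).
pose z : 'rV[F]_(s.+1 + s.+1) :=
  row_mx (poly_rV ('X * rVpoly (lsubmx t))) (poly_rV ('X * rVpoly (rsubmx t))).
have szw (x : 'rV[F]_s) : (size (rVpoly x) <= s.+1)%N by exact: leqW (size_rVpoly x).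
have szX (x : 'rV[F]_s) : (size ('X * rVpoly x)%R <= s.+1)%N by rewrite size_XM_le ?size_rVpoly.
suff [] : (2 * #|A| <= #|B|)%N /\ (#|B| = (2 * #|A|)%N ->
   {in B, forall y, exists2 x, x \in A & y = f x \/ y = z + f x}) by [].
apply: card_double.
- move=> x y /eq_row_mx[/poly_rV_widen_inj e1 /poly_rV_widen_inj e2].
  by rewrite -(hsubmxK x) -(hsubmxK y) e1 // e2.
- by move=> x y; rewrite /f !linearB /= opp_row_mx add_row_mx.
- by move=> x y; rewrite !inE !linearB; apply: lkerB.
- by move=> x; rewrite !inE row_mxKl row_mxKr !poly_rV_K // => /lkerS_sub[].
- move=> x; move: tA; rewrite !inE => /lkerS_sub[_ kt] /lkerS_sub[kx _].
  rewrite /z /f add_row_mx -!linearD row_mxKl row_mxKr !poly_rV_K; first last.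
  + by rewrite (leq_trans (size_polyD _ _)) // geq_max szX szw.
  + by rewrite (leq_trans (size_polyD _ _)) // geq_max szX szw.
  exact: lkerD.
- move=> x xA; apply: contraTneq isT => /eq_row_mx[/(congr1 rVpoly) e1 /(congr1 rVpoly) e2].
  move: e1 e2; rewrite !poly_rV_K // => e1 e2.
  have := tmax x xA; rewrite /= /mu e1 e2.
  have := mu0 t; rewrite (negPf t0) /mu => /negbT.
  (* One component of [t] may be zero, and multiplying it by ['X] does not raise its size. *)
  have szE (p : {poly F}) : size ('X * p) = if p == 0 then 0%N else (size p).+1.
    by case: eqP => [->|/eqP/size_XM //]; rewrite mulr0 size_poly0.
  rewrite !szE -!size_poly_eq0.
  move: (size (rVpoly (lsubmx t))) (size (rVpoly (rsubmx t))) => [|a] [|b] /=;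
    by clear; lia.
Qed.

Lemma rank_hankel2_le s k n (ab : 'rV[F]_n * 'rV[F]_n) :
    (\rank (hankel2 s k.+1 ab) < s + s)%N ->
  (\rank (hankel2 s.+1 k ab) <= (\rank (hankel2 s k.+1 ab)).+1)%N.
Proof.
move=> rk; have := Lker_double rk; rewrite !card_Lker -expnS leq_exp2l //.
by have := rank_hankel2_leql s.+1 k ab; move: rk; lia.
Qed.

(** * Kernels that consist of the multiples of one polynomial *)

Definition multiples m k (f : {poly F}) : {set 'rV[F]_k} :=
  [set poly_rV (rVpoly w * f) | w : 'rV[F]_m].

Lemma size_mulF2 (p q : {poly F}) : p != 0 -> q != 0 ->
  size (p * q) = (size p + size q).-1.
Proof. exact: size_mul. Qed.

Lemma size_mul_bound (w f : {poly F}) m k : (m + size f <= k.+1)%N ->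
  (size w <= m)%N -> (size (w * f)%R <= k)%N.
Proof. by move=> mk wm; have := size_polyMleq w f; lia. Qed.

Lemma multiplesP m k (f : {poly F}) v : (m + size f <= k.+1)%N ->
  reflect (exists2 w : {poly F}, (size w <= m)%N & rVpoly v = w * f)
          (v \in multiples m k f).
Proof.
move=> mk; apply: (iffP imsetP) => [[w _ ->] | [w wm e]].
  by exists (rVpoly w); rewrite ?size_rVpoly // poly_rV_K // (size_mul_bound mk) ?size_rVpoly.
exists (poly_rV w) => //; rewrite poly_rV_K //.
by apply: rVpoly_inj; rewrite poly_rV_K // (size_mul_bound mk).
Qed.

Lemma card_multiples m k (f : {poly F}) : f != 0 -> (m + size f <= k.+1)%N ->
  #|multiples m k f| = (2 ^ m)%N.
Proof.
move=> f0 mk; rewrite card_imset ?card_F2_rV // => w w' /(congr1 rVpoly).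
rewrite !poly_rV_K; try by rewrite (size_mul_bound mk) ?size_rVpoly.
by move/(mulIf f0)/rVpoly_inj.
Qed.

Lemma right_ker_mul s n (ab : 'rV[F]_n * 'rV[F]_n) m (w f : {poly F}) :
    (size w <= m)%N -> (forall i, (i < m)%N -> right_ker s ab ('X^i * f)) ->
  right_ker s ab (w * f).
Proof.
move=> wm kf; apply/rkerP => u us.
by split; rewrite mulrCA (pairing_mul _ _ wm) big1 // => i _;
  have [e1 e2] := rkerP _ _ _ (kf i (ltn_ord i)) u us;
  rewrite mulrCA ?e1 ?e2 mulr0.
Qed.

(** Over two elements all leading coefficients are 1, so they cancel. This is the division step used
    below. *)
Lemma size_sub_lt (p q : {poly F}) : p != 0 -> size p = size q ->
  (size (p - q)%R < size p)%N.
Proof.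
move=> p0 e; have q0 : q != 0 by rewrite -size_poly_eq0 -e size_poly_eq0.
have sp : (0 < size p)%N by rewrite size_poly_gt0.
rewrite -(prednK sp) ltnS; apply/leq_sizeP => i; rewrite leq_eqVlt coefB.
case/predU1P => [<- | lt_i].
  have := lead_coef_eq0 p; have := lead_coef_eq0 q.
  rewrite !lead_coefE -e (negPf p0) (negPf q0) => /negbT/F2_neq0-> /negbT/F2_neq0->.
  by rewrite subrr.
have hi : (size p <= i)%N by move: lt_i; clear; lia.
by rewrite !nth_default ?subr0 -?e.
Qed.

(* Equality in [Rker_double] forces the kernel to be stable under
   multiplication by ['X] as long as the degree allows it; it then consists of
   the multiples of its element of least degree. *)
Lemma Rker_principal s k j n (ab : 'rV[F]_n * 'rV[F]_n) :
    (j < k)%N -> \rank (hankel2 s.+1 k ab) = j ->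
    \rank (hankel2 s k.+1 ab) = j ->
  exists2 f : 'rV[F]_j.+1, f != 0 &
    Rker s k.+1 ab = multiples (k.+1 - j) k.+1 (rVpoly f).
Proof.
move=> jk r1 r2; have [|t [t0 tK tmax]] := @Rker_max s.+1 k n ab; first by rewrite r1.
have [_] := Rker_double t0 tK tmax.
rewrite !card_Rker r1 r2 -expnS -subSn; last exact: ltnW.
move=> /(_ erefl) step; set T := size (rVpoly t) in tmax step *.
have T0 : (0 < T)%N by rewrite size_poly_gt0 rVpoly_eq0.
have Tk : (T <= k)%N by rewrite size_rVpoly.
have Kmax (x : {poly F}) : (size x <= k)%N -> right_ker s.+1 ab x -> (size x <= T)%N.
  by move=> sx kx; have := tmax (poly_rV x); rewrite inE poly_rV_K // => ->.
(* ['X * x] lies in the larger kernel. By the equality case of doubling it is in the smaller one or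
   of the form ['X * rVpoly t + y]; the latter has size [T.+1], which is too large. *)
have closed (x : {poly F}) : (size x < T)%N -> right_ker s.+1 ab x ->
    right_ker s.+1 ab ('X * x).
  move=> xT kx; have sX' := size_XM_le (leqnn (size x)).
  have [_ kX] := rkerS_sub kx.
  have sX : (size ('X * x)%R <= k.+1)%N by rewrite (leq_trans sX') //; lia.
  have [y /andP[sy ky] [->|e]] // := step _ sX kX.
  have sXt : size ('X * rVpoly t) = T.+1 by rewrite size_XM ?rVpoly_eq0.
  have := congr1 (fun p : {poly F} => size p) e; rewrite /= size_polyDl sXt.
    by move=> E; move: sX'; rewrite E ltnS leqNgt xT.
  by rewrite ltnS Kmax.
case: (@arg_minnP _ t [pred v | (v \in Rker s.+1 k ab) && (v != 0)]
  (fun v => size (rVpoly v))) => [|f0 /andP[f0K f00] fmin]; first by rewrite /= tK.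
pose f : {poly F} := rVpoly f0; have fn0 : f != 0 by rewrite rVpoly_eq0.
have kf : right_ker s.+1 ab f by move: f0K; rewrite inE.
have {}fmin (x : {poly F}) : x != 0 -> (size x <= k)%N ->
    right_ker s.+1 ab x -> (size f <= size x)%N.
  move=> x0 sx kx; have := fmin (poly_rV x); rewrite /= inE poly_rV_K // kx; apply.
  by rewrite -rVpoly_eq0 poly_rV_K.
have sfk : (size f <= k)%N by exact: size_rVpoly.
have fT : (size f <= T)%N by exact: Kmax.
clearbody f; clear f0 f0K f00.
have sf : (0 < size f)%N by rewrite size_poly_gt0.
have kXf i : (i < T.+1 - size f)%N -> right_ker s.+1 ab ('X^i * f).
  elim: i => [|i IHi] li; first by rewrite mul1r.
  rewrite exprS -mulrA; apply: closed; last by apply: IHi; lia.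
  by rewrite mulrC size_mulXn //; lia.
(* Division by [f]: a kernel element is at least as long as [f], and subtracting a shift of [f] in
   the kernel shortens it. *)
have div : forall x : {poly F}, (size x <= k)%N -> right_ker s.+1 ab x ->
    exists w : {poly F}, x = w * f.
  move=> x; have [m] := ubnP (size x); elim: m x => // m IHm x xm xk kx.
  have [->|x0] := eqVneq x 0; first by exists 0; rewrite mul0r.
  have fx := fmin x x0 xk kx.
  have xT := Kmax x xk kx.
  have sE : size x = size ('X^(size x - size f) * f).
    by rewrite mulrC size_mulXn // subnK.
  have lt := size_sub_lt x0 sE.
  have [|||w e] := IHm (x - 'X^(size x - size f) * f).
  - by move: lt xm; lia.
  - by move: lt xk; lia.
  - by rewrite rkerB // kXf //; lia.
  by exists (w + 'X^(size x - size f)); rewrite mulrDl -e subrK.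
have quo (x w : {poly F}) m : (size x + 1 <= m + size f)%N -> x = w * f -> (size w <= m)%N.
  have [-> |w0] := eqVneq w 0; first by rewrite size_poly0.
  by move=> xm e; move: xm; rewrite e size_mulF2 //; move: sf; lia.
have {div}Kmul (x : {poly F}) : (size x <= k)%N -> right_ker s.+1 ab x ->
    exists2 w : {poly F}, (size w <= T.+1 - size f)%N & x = w * f.
  move=> xk kx; have [w e] := div x xk kx; exists w => //.
  by have xT := Kmax x xk kx; apply: quo e; lia.
have K1 : Rker s.+1 k ab = multiples (T.+1 - size f) k f.
  have mk : (T.+1 - size f + size f <= k.+1)%N by lia.
  apply/setP => v; apply/idP/(multiplesP _ mk) => [vK | [w wm e]].
    by move: vK; rewrite inE => /(Kmul _ (size_rVpoly v)).
  by rewrite inE e; apply: right_ker_mul wm kXf.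
(* Two counts of the smaller kernel: by its rank, and as a space of multiples of [f]. *)
have Tf : (T.+1 - size f = k - j)%N.
  have := card_Rker s.+1 k ab; rewrite r1 K1 card_multiples //; last by lia.
  by move/eqP; rewrite eqn_exp2l // => /eqP.
have fj : (size f <= j.+1)%N by move: Tf; lia.
exists (poly_rV f); first by rewrite -rVpoly_eq0 poly_rV_K.
have mk : (k.+1 - j + size f <= k.+2)%N by lia.
rewrite poly_rV_K //; apply/eqP; rewrite eqEcard card_Rker r2 card_multiples // leqnn andbT.
apply/subsetP => v; rewrite inE => kv; apply/(multiplesP _ mk).
(* An element of the larger kernel is a multiple of [f], possibly plus ['X * rVpoly t]. As [t] is
   itself a multiple of [f], the cofactor grows in size by at most one. *)
have [x /andP[xk kx] E] := step _ (size_rVpoly v) kv.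
have [w] := Kmul x xk kx; rewrite Tf => sw e.
case: E => ->; first by exists w; rewrite // (leq_trans sw) //; lia.
have [w'] := Kmul (rVpoly t) (size_rVpoly t) ltac:(by move: tK; rewrite inE).
rewrite Tf => sw' e'.
exists ('X * w' + w); last by rewrite e' e mulrDl mulrA.
rewrite (leq_trans (size_polyD _ _)) // geq_max subSn ?(ltnW jk) //.
by rewrite size_XM_le // ltnW.
Qed.

Lemma multiples_bound m j k (f : 'rV[F]_j.+1) : (m + j <= k)%N ->
  (m + size (rVpoly f) <= k.+1)%N.
Proof. by have := size_rVpoly f; lia. Qed.

Lemma rank_of_multiples s k j n (ab : 'rV[F]_n * 'rV[F]_n) (f : 'rV[F]_j.+1) :
    (j <= k)%N -> f != 0 ->
    Rker s k.+1 ab = multiples (k.+1 - j) k.+1 (rVpoly f) ->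
  \rank (hankel2 s k.+1 ab) = j.
Proof.
move=> jk f0 e; have := card_Rker s k.+1 ab; rewrite e card_multiples.
- move/eqP; rewrite eqn_exp2l // => /eqP.
  by have := rank_hankel2_leqr s k.+1 ab; lia.
- by rewrite rVpoly_eq0.
- by apply: multiples_bound; lia.
Qed.

(** By [rkerS], [v] is in the smaller kernel when [v] and ['X * v] are in the larger one. For
    [v = w * f] this bounds the size of ['X * w] by [k.+1 - j], hence that of [w] by [k - j]. *)
Lemma rankS_of_multiples s k j n (ab : 'rV[F]_n * 'rV[F]_n) (f : 'rV[F]_j.+1) :
    (0 < s)%N -> (j < k)%N -> f != 0 ->
    Rker s k.+1 ab = multiples (k.+1 - j) k.+1 (rVpoly f) ->
  \rank (hankel2 s.+1 k ab) = j.
Proof.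
move=> s0 jk f0 e; have szf := size_rVpoly f.
have f0' : rVpoly f != 0 by rewrite rVpoly_eq0.
have mk : (k - j + size (rVpoly f) <= k.+1)%N by lia.
have mk' : (k.+1 - j + size (rVpoly f) <= k.+2)%N by lia.
have kE (v : {poly F}) : (size v <= k.+1)%N ->
    reflect (exists2 w : {poly F}, (size w <= k.+1 - j)%N & v = w * rVpoly f)
            (right_ker s ab v).
  move=> sv; have : right_ker s ab v = (poly_rV v \in Rker s k.+1 ab).
    by rewrite inE poly_rV_K.
  by rewrite e => ->; have := multiplesP (poly_rV v) mk'; rewrite poly_rV_K.
have E : Rker s.+1 k ab = multiples (k - j) k (rVpoly f).
  apply/setP => v; rewrite inE rkerS //.
  have sv := size_rVpoly v; have sX := size_XM_le sv.
  apply/andP/(multiplesP _ mk) => [[kv kX] | [w sw ->]].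
    have [w sw ew] := kE _ (leqW sv) kv; have [w' sw' ew'] := kE _ sX kX.
    exists w => //; have eww : 'X * w = w'.
      by apply: (mulIf f0'); rewrite -mulrA -ew.
    have [->|w0] := eqVneq w 0; first by rewrite size_poly0.
    by move: sw'; rewrite -eww size_XM //; lia.
  have swf := size_mul_bound mk sw.
  split; first by apply/(kE _ (leqW swf)); exists w => //; lia.
  apply/(kE _ (size_XM_le swf)); exists ('X * w); last by rewrite mulrA.
  by rewrite subSn ?size_XM_le // ltnW.
have := card_Rker s.+1 k ab; rewrite E card_multiples //.
move/eqP; rewrite eqn_exp2l // => /eqP.
by have := rank_hankel2_leqr s.+1 k ab; lia.
Qed.

(** * Counting pairs with a principal kernel *)

Definition annihilates m (f : {poly F}) n (a : 'rV[F]_n) : bool :=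
  [forall i : 'I_m, pairing a ('X^i * f) == 0].

Lemma annihilatesP m f n (a : 'rV[F]_n) :
  reflect (forall w : {poly F}, (size w <= m)%N -> pairing a (w * f) = 0)
          (annihilates m f a).
Proof.
apply: (iffP forallP) => [fa w wm | fa i]; last by rewrite fa ?size_polyXn.
by rewrite (pairing_mul _ _ wm) big1 // => i _; rewrite (eqP (fa i)) mulr0.
Qed.

(** The [m] linear conditions on [a] are independent, because the shifts of [f] are linearly
    independent and short enough for [pairing] to see all their coefficients. *)
Lemma card_annihilates m (f : {poly F}) n : f != 0 -> (m + size f <= n.+1)%N ->
  #|[set a : 'rV[F]_n | annihilates m f a]| = (2 ^ (n - m))%N.
Proof.
move=> f0 mn; pose A : 'M[F]_(n, m) := \matrix_(j, i) ('X^i * f)`_j.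
have aA (a : 'rV[F]_n) i : (a *m A) 0 i = pairing a ('X^i * f).
  by rewrite mxE; apply: eq_bigr => j _; rewrite mxE.
have Au (u : 'rV[F]_m) j : (u *m A^T) 0 j = (rVpoly u * f)`_j.
  rewrite mxE [in RHS]/rVpoly poly_def mulr_suml coef_sum.
  apply: eq_bigr => i _; rewrite !mxE -scalerAl coefZ.
  by rewrite -coef_rVpoly_ord coef_rVpoly.
have rA : \rank A = m.
  rewrite -mxrank_tr; apply/eqP; rewrite -/(row_free _) -kermx_eq0.
  apply/rowV0P => u /sub_kermxP e.
  apply/eqP; rewrite -rVpoly_eq0 -(mulIr_eq0 _ (mulIf f0)); apply/eqP/polyP => j.
  rewrite coef0; have [jn|nj] := ltnP j n.
    by rewrite -(Au u (Ordinal jn)) e mxE.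
  rewrite nth_default // (leq_trans _ nj) //.
  exact: size_mul_bound mn (size_rVpoly u).
rewrite -{2}rA -card_mulmx_eq0; apply: eq_card => a; rewrite !inE.
apply/forallP/eqP => [fa | e i]; last by rewrite -aA e mxE.
by apply/rowP => i; rewrite aA mxE; apply/eqP.
Qed.

(** * Pulling functionals back along multiplication by a polynomial *)

Lemma size_subF2 (p q : {poly F}) : (size (p - q)%R <= maxn (size p) (size q))%N.
Proof. by rewrite (leq_trans (size_polyD _ _)) ?size_polyN. Qed.

(** Multiply a Bezout relation by [p] and reduce the cofactor of [f] modulo [h]. This gives [w] of
    size at most [d], and [u * h = p - w * f] then bounds the size of [u]. *)
Lemma bezout_bounded (f h p : {poly F}) j d m :
    coprimep f h -> (size f <= j.+1)%N -> size h = d.+1 -> (j <= m)%N ->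
    (size p <= m + d)%N ->
  exists w u : {poly F},
    [/\ (size w <= m + d - j)%N, (size u <= m)%N & p = w * f + u * h].
Proof.
move=> /Bezout_eq1_coprimepP[[u1 u2] e] fj hd jm pm; rewrite [_.1]/= [_.2]/= in e.
have h0 : h != 0 by rewrite -size_poly_gt0 hd.
have [w [u [sw pE]]] : exists w u : {poly F}, (size w <= d)%N /\ p = w * f + u * h.
  exists ((p * u1) %% h), ((p * u1) %/ h * f + p * u2).
  split; first by rewrite -ltnS -hd ltn_modp.
  rewrite -[LHS]mulr1 -e mulrDr !mulrA {1}(divp_eq (p * u1) h); ring.
exists w, u; split=> //; first by move: sw jm; lia.
have [-> |u0] := eqVneq u 0; first by rewrite size_poly0.
have uh : u * h = p - w * f by rewrite {1}pE addrC addKr.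
have sE : size (u * h) = size (p - w * f) by rewrite uh.
move: sE; rewrite size_mulF2 // hd.
have := size_subF2 p (w * f).
by have := size_polyMleq w f; move: sw fj pm jm; lia.
Qed.

Definition pull (h : {poly F}) n N (a : 'rV[F]_N) : 'rV[F]_n :=
  \row_i pairing a ('X^i * h).

Lemma pairing_pull h n N (a : 'rV[F]_N) (p : {poly F}) : (size p <= n)%N ->
  pairing (pull h n a) p = pairing a (p * h).
Proof.
move=> pn; rewrite (pairing_mul _ _ pn); apply: eq_bigr => i _.
by rewrite mxE mulrC.
Qed.

Lemma pullB h n N (a b : 'rV[F]_N) : pull h n (a - b) = pull h n a - pull h n b.
Proof. by apply/rowP => i; rewrite !mxE pairingBl. Qed.

(* For [h] coprime to [f], the polynomials of degree less than [n + d] are sums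
   of a multiple of [f] and a multiple of [h]. *)
Lemma pull_inj (f h : {poly F}) j d n :
    coprimep f h -> (size f <= j.+1)%N -> size h = d.+1 -> (j <= n)%N ->
  {in [set a : 'rV[F]_(n + d) | annihilates (n + d - j) f a] &,
   injective (pull h n (N := n + d))}.
Proof.
move=> cfh fj hd jn a b; rewrite !inE => /annihilatesP fa /annihilatesP fb e.
apply/eqP; rewrite -subr_eq0; apply/eqP/pairing_eq0 => p pn.
have [w [u [sw su ->]]] := bezout_bounded cfh fj hd jn pn.
rewrite pairingD -(@pairing_pull h n _ (a - b) u su) pullB e subrr.
rewrite pairingBl fa // fb // subrr add0r /pairing big1 // => i _.
by rewrite mxE mul0r.
Qed.

Lemma pull_annihilates (f h : {poly F}) j d n (a : 'rV[F]_(n + d)) :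
    (size f <= j.+1)%N -> size h = d.+1 -> (j <= n)%N ->
    annihilates (n + d - j) f a -> annihilates (n - j) f (pull h n a).
Proof.
move=> fj hd jn /annihilatesP fa; apply/annihilatesP => w wn.
rewrite pairing_pull; last by have := size_polyMleq w f; move: wn fj jn; lia.
have swh : (size (w * h)%R <= n + d - j)%N.
  by have := size_polyMleq w h; rewrite hd; move: wn jn; lia.
by rewrite mulrAC fa.
Qed.

(** Both annihilators have [2 ^ j] elements, so the injective pullback between them is onto. *)
Lemma pull_onto (f h : {poly F}) j d n (b : 'rV[F]_n) :
    f != 0 -> coprimep f h -> (size f <= j.+1)%N -> size h = d.+1 -> (j <= n)%N ->
    annihilates (n - j) f b ->
  exists2 a : 'rV[F]_(n + d), annihilates (n + d - j) f a & pull h n a = b.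
Proof.
move=> f0 cfh fj hd jn fb.
pose A := [set a : 'rV[F]_(n + d) | annihilates (n + d - j) f a].
pose B := [set b : 'rV[F]_n | annihilates (n - j) f b].
have /eqP AB : pull h n (N := n + d) @: A == B.
  rewrite eqEcard card_in_imset; last exact: (pull_inj cfh fj hd).
  apply/andP; split.
    apply/subsetP => _ /imsetP[a + ->]; rewrite !inE.
    exact: pull_annihilates fj hd jn.
  rewrite !card_annihilates //; try by move: fj jn; lia.
  by rewrite leq_exp2l //; move: jn; lia.
have : b \in B by rewrite inE.
by rewrite -AB => /imsetP[a]; rewrite inE => fa ->; exists a.
Qed.

(** The cofactor bound is fixed by [j] and not by the degree of [f], since a kernel for rank [j] may
    be generated by a polynomial of degree less than [j]. *)
Definition principal n s k j (f : 'rV[F]_j.+1) : {set 'rV[F]_n * 'rV[F]_n} :=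
  [set ab | Rker s k.+1 ab == multiples (k.+1 - j) k.+1 (rVpoly f)].

(** That the multiples of [f] lie in the kernel is a condition on each sequence separately: a test
    polynomial of size at most [s] times a cofactor of size at most [k.+1 - j] has size at most
    [s + k - j]. The third clause is the reverse inclusion. *)
Lemma principalP n s k j (f : 'rV[F]_j.+1) (ab : 'rV[F]_n * 'rV[F]_n) :
    (0 < s)%N -> (j <= k)%N ->
  reflect [/\ annihilates (s + k - j) (rVpoly f) ab.1,
              annihilates (s + k - j) (rVpoly f) ab.2
            & forall v : {poly F}, (size v <= k.+1)%N -> right_ker s ab v ->
                exists2 w : {poly F}, (size w <= k.+1 - j)%N & v = w * rVpoly f]
          (ab \in principal n s k f).
Proof.
move=> s0 jk; have mk : (k.+1 - j + size (rVpoly f) <= k.+2)%N.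
  by apply: multiples_bound; lia.
rewrite inE; apply: (iffP eqP) => [e | [f1 f2 kv]].
  have kf i : (i < s + k - j)%N ->
      pairing ab.1 ('X^i * rVpoly f) = 0 /\ pairing ab.2 ('X^i * rVpoly f) = 0.
    (* The exponent is split into a row index [i1 < s] and a cofactor exponent [i2 < k.+1 - j]. *)
    move=> li; pose i1 := minn i s.-1; pose i2 := (i - i1)%N.
    have l1 : (i1 < s)%N by rewrite /i1; lia.
    have l2 : (i2 < k.+1 - j)%N by rewrite /i2 /i1; lia.
    have -> : 'X^i * rVpoly f = 'X^i1 * ('X^i2 * rVpoly f).
      by rewrite mulrA -exprD /i2 subnKC // geq_minl.
    have : poly_rV ('X^i2 * rVpoly f) \in Rker s k.+1 ab.
      rewrite e; apply/(multiplesP _ mk); exists 'X^i2; first by rewrite size_polyXn.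
      by rewrite poly_rV_K // (size_mul_bound mk) ?size_polyXn.
    rewrite inE poly_rV_K; last by rewrite (size_mul_bound mk) ?size_polyXn.
    by move/rkerP; apply; rewrite size_polyXn.
  split; try by apply/forallP => i; apply/eqP; have [] := kf i (ltn_ord i).
  move=> v sv kv; have : poly_rV v \in Rker s k.+1 ab by rewrite inE poly_rV_K.
  by rewrite e => /(multiplesP _ mk); rewrite poly_rV_K.
apply/setP => v; apply/idP/(multiplesP _ mk) => [|[w sw e]].
  by rewrite inE; apply: kv; apply: size_rVpoly.
rewrite inE e; apply/rkerP => u su.
have suw : (size (u * w)%R <= s + k - j)%N.
  by have := size_polyMleq u w; move: su sw jk s0; lia.
by rewrite mulrA; split; [apply: (annihilatesP _ _ _ f1) | apply: (annihilatesP _ _ _ f2)].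
Qed.

Definition pull2 h n N (ab : 'rV[F]_N * 'rV[F]_N) : 'rV[F]_n * 'rV[F]_n :=
  (pull h n ab.1, pull h n ab.2).

Lemma right_ker_pull2 h s k N (ab : 'rV[F]_N * 'rV[F]_N) (v : {poly F}) :
    (0 < s)%N -> (size v <= k.+1)%N ->
  right_ker s (pull2 h (s + k) ab) v = right_ker s ab (v * h).
Proof.
move=> s0 sv; have suv (u : {poly F}) : (size u <= s)%N -> (size (u * v)%R <= s + k)%N.
  by move=> su; have := size_polyMleq u v; move: su sv s0; lia.
apply/rkerP/rkerP => kv u su.
  by rewrite mulrA -!(@pairing_pull h (s + k)) ?suv //; apply: kv.
by rewrite !pairing_pull ?suv // -!mulrA; apply: kv.
Qed.

(** The kernel of the pulled back pair consists of the [v] with [v * h] in the original kernel. From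
    left to right, write [v = w * f + u * h] and apply the hypothesis to [u]; from right to left,
    [f] divides [v * h] and hence [v]. *)
Lemma principal_pull2 s k d j (f : 'rV[F]_j.+1) h
    (ab : 'rV[F]_(s + k + d) * 'rV[F]_(s + k + d)) :
    (0 < s)%N -> (j <= k)%N -> f != 0 ->
    coprimep (rVpoly f) h -> size h = d.+1 ->
    annihilates (s + k + d - j) (rVpoly f) ab.1 ->
    annihilates (s + k + d - j) (rVpoly f) ab.2 ->
  (pull2 h (s + k) ab \in principal (s + k) s k f) =
  (ab \in principal (s + k + d) s (k + d) f).
Proof.
move=> s0 jk f0 cfh hd f1 f2; have fn0 : rVpoly f != 0 by rewrite rVpoly_eq0.
have szf := size_rVpoly f; have h0 : h != 0 by rewrite -size_poly_gt0 hd.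
have jkd : (j <= k + d)%N by lia.
have jsk : (j <= s + k)%N by lia.
apply/(principalP _ _ s0 jk)/(principalP _ _ s0 jkd) => [[_ _ kE] | [_ _ kE]].
  rewrite !addnA; split=> // v sv kv.
  have [||w [u [sw su vE]]] := @bezout_bounded (rVpoly f) h v j d k.+1 cfh szf hd.
  - exact: leqW.
  - by rewrite addSn.
  have [|w2 sw2 uE] := kE u su.
    rewrite right_ker_pull2 //.
    have -> : u * h = v - w * rVpoly f by rewrite vE addrC addKr.
    rewrite rkerB //; apply/rkerP => u' su'.
    have suw : (size (u' * w)%R <= s + k + d - j)%N.
      by have := size_polyMleq u' w; move: su' sw jk s0; lia.
    by rewrite mulrA; split; [apply: (annihilatesP _ _ _ f1) | apply: (annihilatesP _ _ _ f2)].
  exists (w + w2 * h); last by rewrite vE uE; ring.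
  rewrite (leq_trans (size_polyD _ _)) // geq_max -addSn sw.
  by have := size_polyMleq w2 h; rewrite hd; move: sw2 jk; lia.
split; try exact: pull_annihilates szf hd jsk _.
move=> v sv; rewrite right_ker_pull2 // => kv.
have [|w sw vE] := kE (v * h) _ kv.
  by have := size_polyMleq v h; rewrite hd; move: sv; lia.
have : rVpoly f %| v by rewrite -(Gauss_dvdpl _ cfh) vE dvdp_mull.
case/dvdpP => w' e; exists w' => //.
have ww : w = w' * h by apply: (mulIf fn0); rewrite -vE e mulrAC.
have [-> |w0] := eqVneq w' 0; first by rewrite size_poly0.
by move: sw; rewrite ww size_mulF2 // hd; move: jk; lia.
Qed.

Lemma card_principal_add s k d j (f : 'rV[F]_j.+1) h :
    (0 < s)%N -> (j <= k)%N -> f != 0 ->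
    coprimep (rVpoly f) h -> size h = d.+1 ->
  #|principal (s + k + d) s (k + d) f| = #|principal (s + k) s k f|.
Proof.
move=> s0 jk f0 cfh hd; have fn0 : rVpoly f != 0 by rewrite rVpoly_eq0.
have szf := size_rVpoly f.
have jkd : (j <= k + d)%N by lia.
have jsk : (j <= s + k)%N by lia.
have pinj := pull_inj cfh szf hd jsk.
rewrite -[LHS](@card_in_imset _ _ (pull2 h (s + k) (N := s + k + d))).
  apply: eq_card => cd; apply/imsetP/idP => [[ab abP ->] | cdP].
    have [+ + _] := principalP _ _ s0 jkd abP; rewrite !addnA => f1 f2.
    by rewrite principal_pull2.
  have [f1 f2 _] := principalP _ _ s0 jk cdP.
  have [a fa ea] := pull_onto fn0 cfh szf hd jsk f1.
  have [b fb eb] := pull_onto fn0 cfh szf hd jsk f2.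
  have e : cd = pull2 h (s + k) (a, b) by rewrite /pull2 /= ea eb; case: (cd).
  exists (a, b) => //.
  by rewrite -(principal_pull2 (h := h)) // -e.
move=> [a b] [a' b'] /(principalP _ _ s0 jkd)[f1 f2 _] /(principalP _ _ s0 jkd)[f1' f2' _].
move: f1 f2 f1' f2'; rewrite !addnA /= => f1 f2 f1' f2' [e1 e2].
by congr (_, _); apply: pinj; rewrite ?inE.
Qed.

(* A linear form coprime to [f] need not exist over a field with two elements,
   but there are coprime forms of two consecutive degrees. *)
Lemma card_principalS s k j (f : 'rV[F]_j.+1) :
    (0 < s)%N -> (j <= k)%N -> f != 0 ->
  #|principal (s + k.+1) s k.+1 f| = #|principal (s + k) s k f|.
Proof.
move=> s0 jk f0; have fn0 : rVpoly f != 0 by rewrite rVpoly_eq0.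
pose h t := rVpoly f * 'X^(t.+1) + 1; pose d := size (rVpoly f).
have hd t : size (h t) = (d + t).+1.
  have e := size_mulXn t.+1 fn0.
  by rewrite size_polyDl e ?size_poly1 ?addSn ?(addnC d) // ltnS addn_gt0 size_poly_gt0 fn0 orbT.
have ch t : coprimep (rVpoly f) (h t).
  by apply/Bezout_eq1_coprimepP; exists (- 'X^(t.+1), 1); rewrite /h /=; ring.
(* With degrees [d.+1] and [d], both counts are lifted to the same number of columns:
   [k + d.+1 = k.+1 + d]. *)
rewrite -(card_principal_add s0 jk f0 (ch 1%N) (hd 1%N)).
rewrite -(card_principal_add s0 (leqW jk) f0 (ch 0%N) (hd 0%N)).
by rewrite addn0 addn1 !addSnnS -!addnA !addSnnS.
Qed.

Lemma card_principal s k j (f : 'rV[F]_j.+1) :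
    (0 < s)%N -> (j <= k)%N -> f != 0 ->
  #|principal (s + k) s k f| = #|principal (s + j) s j f|.
Proof.
move=> s0 jk f0; rewrite -(subnKC jk); elim: (k - j)%N => [|m IHm].
  by rewrite addn0.
by rewrite addnS card_principalS ?leq_addr.
Qed.

Definition principal_pairs n s k j : {set 'rV[F]_n * 'rV[F]_n} :=
  [set ab | [exists f : 'rV[F]_j.+1, (f != 0) && (ab \in principal n s k f)]].

(** The cofactor 1 is allowed as [j <= k], so [f] and [g] divide each other; associates over two
    elements are equal. *)
Lemma multiples_inj j k (f g : 'rV[F]_j.+1) : (j <= k)%N -> f != 0 -> g != 0 ->
  multiples (k.+1 - j) k.+1 (rVpoly f) = multiples (k.+1 - j) k.+1 (rVpoly g) -> f = g.
Proof.
move=> jk; have mk (x : 'rV[F]_j.+1) : (k.+1 - j + size (rVpoly x) <= k.+2)%N.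
  by apply: multiples_bound; lia.
have dvd (x y : 'rV[F]_j.+1) :
    multiples (k.+1 - j) k.+1 (rVpoly x) = multiples (k.+1 - j) k.+1 (rVpoly y) ->
    rVpoly y %| rVpoly x.
  move=> e; have sx : (size (rVpoly x) <= k.+1)%N.
    by have := size_rVpoly x; move: jk; lia.
  have : poly_rV (rVpoly x) \in multiples (k.+1 - j) k.+1 (rVpoly x).
    apply/(multiplesP _ (mk x)); exists 1; last by rewrite poly_rV_K // mul1r.
    by rewrite size_poly1; lia.
  rewrite e => /(multiplesP _ (mk y))[w _]; rewrite poly_rV_K // => ->.
  by rewrite dvdp_mull.
move=> f0 g0 e; have : rVpoly f %= rVpoly g.
  by rewrite /eqp (dvd _ _ e) (dvd _ _ (esym e)).
case/eqpf_eq => c c0 E; apply: rVpoly_inj.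
by rewrite E (F2_neq0 c0) scale1r.
Qed.

Lemma card_principal_pairs n s k j : (j <= k)%N ->
  #|principal_pairs n s k j| = (\sum_(f : 'rV[F]_j.+1 | f != 0%R) #|principal n s k f|)%N.
Proof.
move=> jk; under [RHS]eq_bigr do rewrite -sum1_card big_mkcond /=.
rewrite exchange_big /= -sum1_card big_mkcond /=; apply: eq_bigr => ab _.
rewrite inE; case: existsP => [[f /andP[f0 fab]] | nf].
  rewrite (bigD1 f) //= fab big1 // => g /andP[g0 gf].
  case: ifP => // gab; case/eqP: gf; apply: (@multiples_inj j k) => //.
  by move: fab gab; rewrite !inE => /eqP<- /eqP.
rewrite big1 // => f f0; case: ifP => // fab; case: nf.
by exists f; rewrite f0.
Qed.

Lemma card_principal_pairs_const s k j : (0 < s)%N -> (j <= k)%N ->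
  #|principal_pairs (s + k) s k j| = #|principal_pairs (s + j) s j j|.
Proof.
move=> s0 jk; rewrite !card_principal_pairs //; apply: eq_bigr => f f0.
exact: card_principal.
Qed.

(** * Recursion and moments for the rank distribution *)

Definition rank_count (n s k i : nat) : nat :=
  #|[set ab : 'rV[F]_n * 'rV[F]_n | \rank (hankel2 s k ab) == i]|.

Lemma principal_pairsE n s k j : (0 < s)%N -> (j < k)%N ->
  principal_pairs n s k j =
  [set ab | (\rank (hankel2 s.+1 k ab) == j) && (\rank (hankel2 s k.+1 ab) == j)].
Proof.
move=> s0 jk; apply/setP => ab; rewrite !inE.
apply/existsP/andP => [[f /andP[f0]] | [/eqP r1 /eqP r2]].
  rewrite inE => /eqP e.
  by rewrite (rankS_of_multiples s0 jk f0 e) (rank_of_multiples (ltnW jk) f0 e).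
have [f f0 e] := Rker_principal jk r1 r2.
by exists f; rewrite f0 inE e eqxx.
Qed.

(** For [k = j] the kernel has two elements, so it is spanned by its only nonzero element. *)
Lemma card_principal_pairs_diag s j :
  #|principal_pairs (s + j) s j j| = rank_count (s + j) s j.+1 j.
Proof.
apply: eq_card => ab; rewrite !inE; apply/existsP/eqP => [[f /andP[f0]] | r].
  by rewrite inE => /eqP e; apply: rank_of_multiples f0 e.
have cK : #|Rker s j.+1 ab| = 2%N by rewrite card_Rker r subSnn.
have [|f [f0 fK _]] := @Rker_max s j.+1 _ ab; first by rewrite r.
exists f; rewrite f0 inE eq_sym eqEcard card_multiples ?rVpoly_eq0 //; last first.
  by apply: multiples_bound; lia.
rewrite cK subSnn leqnn andbT; apply/subsetP => v /multiplesP[|w].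
  by apply: multiples_bound; lia.
move=> sw e; rewrite inE e; apply: (right_ker_mul sw) => -[|i] //.
by rewrite mul1r; move: fK; rewrite inE.
Qed.

(** Rank [i.+1] in the first shape goes with rank [i.+1] or [i] in the second, and rank [i] in the
    second with rank [i] or [i.+1] in the first. The mixed class [(i.+1, i)] cancels, and the two
    classes of equal ranks do not depend on [k]. *)
Lemma rank_count_rec s k i :
    (0 < s)%N -> (i.+1 < k)%N -> (i < s + s)%N ->
  (rank_count (s + k) s.+1 k i.+1 + rank_count (s + i) s i.+1 i =
   rank_count (s + k) s k.+1 i + rank_count (s + i.+1) s i.+2 i.+1)%N.
Proof.
move=> s0 ik i2s; set n := (s + k)%N.
pose r1 (ab : 'rV[F]_n * 'rV[F]_n) := \rank (hankel2 s.+1 k ab).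
pose r2 (ab : 'rV[F]_n * 'rV[F]_n) := \rank (hankel2 s k.+1 ab).
have diag j : (j < k)%N ->
    rank_count (s + j) s j.+1 j = #|[set ab | (r1 ab == j) && (r2 ab == j)]|.
  move=> jk; rewrite -card_principal_pairs_diag -(@card_principal_pairs_const s k j) ?(ltnW jk) //.
  by rewrite principal_pairsE.
rewrite !diag //; last exact: ltnW.
have -> : rank_count n s.+1 k i.+1 = (#|[set ab | (r1 ab == i.+1) && (r2 ab == i.+1)]|
                                 + #|[set ab | (r1 ab == i.+1) && (r2 ab == i)]|)%N.
  rewrite -cardsUI (_ : _ :&: _ = set0) ?cards0 ?addn0; last first.
    by apply/setP => ab; rewrite !inE; lia.
  apply: eq_card => ab; rewrite !inE -/(r1 ab).
  have := @rank_hankel2_ge s k n ab; have := @rank_hankel2_le s k n ab.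
  have := rank_hankel2_leql s k.+1 ab.
  by rewrite -/(r1 ab) -/(r2 ab); lia.
have -> : rank_count n s k.+1 i = (#|[set ab | (r1 ab == i) && (r2 ab == i)]|
                                 + #|[set ab | (r1 ab == i.+1) && (r2 ab == i)]|)%N.
  rewrite -cardsUI (_ : _ :&: _ = set0) ?cards0 ?addn0; last first.
    by apply/setP => ab; rewrite !inE; lia.
  apply: eq_card => ab; rewrite !inE -/(r2 ab).
  have := @rank_hankel2_ge s k n ab; have := @rank_hankel2_le s k n ab.
  have := rank_hankel2_leqr s.+1 k ab.
  by rewrite -/(r1 ab) -/(r2 ab); lia.
by lia.
Qed.

Lemma sum_rank_count n s k (g : nat -> nat) :
  (\sum_(ab : 'rV[F]_n * 'rV[F]_n) g (\rank (hankel2 s k ab)) =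
   \sum_(i < (s + s).+1) rank_count n s k i * g i)%N.
Proof.
pose r (ab : 'rV[F]_n * 'rV[F]_n) : 'I_(s + s).+1 := inord (\rank (hankel2 s k ab)).
have rE ab : r ab = \rank (hankel2 s k ab) :> nat.
  by rewrite inordK // ltnS rank_hankel2_leql.
rewrite (partition_big r xpredT) //=; apply: eq_bigr => i _.
rewrite (eq_bigr (fun=> g i)); last by move=> ab /eqP<-; rewrite rE.
rewrite sum_nat_const; congr (_ * _)%N; apply: eq_card => ab.
by rewrite inE unfold_in -rE.
Qed.

Lemma rank_count_moment0 n s k :
  (\sum_(i < (s + s).+1) rank_count n s k i = 4 ^ n)%N.
Proof.
transitivity (\sum_(i < (s + s).+1) rank_count n s k i * 1)%N.
  by apply: eq_bigr => i _; rewrite muln1.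
rewrite -(@sum_rank_count n s k (fun=> 1%N)) sum1_card card_prod !card_F2_rV.
by rewrite -expnMn.
Qed.

(** Count the triples of a pair and a kernel vector [v] in two ways. The vector 0 belongs to all
    [4 ^ n] pairs; any other [v] imposes [s] independent conditions on each of the two sequences. *)
Lemma rank_count_moment1 n s k : (s + k = n.+1)%N ->
  (\sum_(i < (s + s).+1) rank_count n s k i * 2 ^ (k - i) =
   4 ^ n + (2 ^ k - 1) * 4 ^ (n - s))%N.
Proof.
move=> skn; rewrite -(sum_rank_count n s k (fun i => 2 ^ (k - i))%N).
under eq_bigr do rewrite -card_Rker -sum1_card big_mkcond /=.
rewrite exchange_big /= (bigD1 0%R) //=; congr (_ + _)%N.
  under eq_bigr do rewrite inE linear0 rker0.
  by rewrite sum1_card card_prod !card_F2_rV -expnMn.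
rewrite (eq_bigr (fun=> 4 ^ (n - s))%N) => [|v v0].
  rewrite sum_nat_const; congr (_ * _)%N.
  by rewrite cardC1 card_F2_rV subn1.
rewrite -big_mkcond sum1_card.
pose A := [set a : 'rV[F]_n | annihilates s (rVpoly v) a].
have cA : #|A| = (2 ^ (n - s))%N.
  rewrite card_annihilates ?rVpoly_eq0 //.
  by rewrite -skn leq_add2l size_rVpoly.
transitivity #|setX A A|; last by rewrite cardsX cA -expnMn.
apply: eq_card => ab; rewrite [LHS](_ : _ = (v \in Rker s k ab)) // !inE.
apply/forallP/andP => [kv | [/forallP k1 /forallP k2] i].
  by split; apply/forallP => i; have /andP[] := kv i.
by rewrite k1 k2.
Qed.

Lemma hankel_eq0 s k n (a : 'rV[F]_n) : (0 < s)%N -> (0 < k)%N ->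
  (s + k = n.+1)%N -> hankel s k a = 0 -> a = 0.
Proof.
move=> s0 k0 skn e; apply/rowP => m; rewrite mxE -pairingXn.
have l1 : (minn m s.-1 < s)%N by lia.
have l2 : (m - minn m s.-1 < k)%N by have := ltn_ord m; lia.
have := congr1 (fun M : 'M_(s, k) => M (Ordinal l1) (Ordinal l2)) e.
by rewrite !mxE /= subnKC // geq_minl.
Qed.

Lemma rank_count0 n s k : (0 < s)%N -> (0 < k)%N -> (s + k = n.+1)%N ->
  rank_count n s k 0 = 1%N.
Proof.
move=> s0 k0 skn; rewrite -(cards1 (0 : 'rV[F]_n * 'rV[F]_n)).
apply: eq_card => -[a b]; rewrite !inE mxrank_eq0 col_mx_eq0 /=.
apply/andP/eqP => [[/eqP e1 /eqP e2] | [-> ->]].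
  by rewrite (hankel_eq0 s0 k0 skn e1) (hankel_eq0 s0 k0 skn e2).
by split; apply/eqP/matrixP => i j; rewrite !mxE /pairing big1 // => l _; rewrite mxE mul0r.
Qed.

(** * From persymmetric matrices to sequences *)

Lemma hankelB s k n (a b : 'rV[F]_n) : hankel s k (a - b) = hankel s k a - hankel s k b.
Proof. by apply/matrixP => i j; rewrite !mxE pairingBl. Qed.

Lemma persymmetric_hankel s k n (a : 'rV[F]_n) : persymmetric (hankel s k a).
Proof.
apply/forallP => i; apply/forallP => j; apply/forallP => p; apply/forallP => q.
by apply/implyP => /eqP e; rewrite !mxE e.
Qed.

Lemma persymmetricP s k n (A : 'M[F]_(s, k)) : (0 < s)%N -> (0 < k)%N ->
  (s + k = n.+1)%N -> persymmetric A -> exists a : 'rV[F]_n, A = hankel s k a.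
Proof.
case: s A => // s; case: k => // k A _ _ skn pA.
(* The sequence is read down the first column and then along the last row, whose index is [s]
   here. *)
exists (\row_m A (inord (minn m s)) (inord (m - minn m s))).
apply/matrixP => i j; rewrite mxE; have li := ltn_ord i; have lj := ltn_ord j.
have lm : (i + j < n)%N by lia.
rewrite (pairingXn _ (Ordinal lm)) mxE /=.
move/forallP/(_ i)/forallP/(_ j)/forallP: pA.
move=> /(_ (inord (minn (i + j) s)))/forallP/(_ (inord (i + j - minn (i + j) s))).
by move/implyP => pA; apply/eqP/pA; rewrite !inordK; lia.
Qed.

Lemma Gamma_rank_count i s k n : (0 < s)%N -> (0 < k)%N -> (s + k = n.+1)%N ->
  Gamma i s k = rank_count n s k i.
Proof.
move=> s0 k0 skn.
have inj : injective (@hankel2 s k n).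
  move=> [a b] [a' b'] /eq_col_mx[/= e1 e2].
  have eqE (x y : 'rV[F]_n) : hankel s k x = hankel s k y -> x = y.
    move=> e; apply/eqP; rewrite -subr_eq0; apply/eqP/(hankel_eq0 s0 k0 skn).
    by rewrite hankelB e subrr.
  by rewrite (eqE _ _ e1) (eqE _ _ e2).
rewrite /rank_count -(card_imset _ inj); apply: eq_card => M; rewrite inE.
apply/andP/imsetP => [[/existsP[A /existsP[B /and3P[pA pB /eqP->]]] /eqP r] | [ab + ->]].
  have [a eA] := @persymmetricP s k n A s0 k0 skn pA.
  have [b eB] := @persymmetricP s k n B s0 k0 skn pB.
  exists (a, b); last by rewrite eA eB.
  by rewrite inE /hankel2 /= -eA -eB; apply/eqP.
rewrite inE => r; split=> //; apply/existsP; exists (hankel s k ab.1).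
by apply/existsP; exists (hankel s k ab.2); rewrite !persymmetric_hankel /=.
Qed.

(** * Solving the recursion *)

(** Here [X], [Y], [Z] stand for [2 ^+ s], [2 ^+ k], [2 ^+ i], which turns the identities to be
    proved into identities of rational functions. *)
Definition low (Z : rat) : rat := 21 * Z ^+ 3 / 16 - 3 * Z ^+ 2 / 8.

Definition middle (X Y : rat) : rat :=
  3 * Y * X / 2 + 21 * X ^+ 3 / 16 - 27 * X ^+ 2 / 8.

Definition high (X Y Z : rat) : rat :=
  21 * (Y * Z ^+ 3 / (16 * X ^+ 2) + Z ^+ 3 / 16 - 5 * Z ^+ 4 / (32 * X ^+ 2)).

Definition full (X Y : rat) : rat :=
  Y ^+ 2 * X ^+ 2 / 4 - 3 * Y * X ^+ 4 / 16 + X ^+ 6 / 32.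

(** Rank 0 needs its own case, as [low 1] is 15/16. *)
Definition rank_formula (s k i : nat) : rat :=
  if i == 0%N then 1 else if (i < s)%N then low (2 ^+ i)
  else if i == s then middle (2 ^+ s) (2 ^+ k)
  else if (i < s + s)%N then high (2 ^+ s) (2 ^+ k) (2 ^+ i)
  else full (2 ^+ s) (2 ^+ k).

Lemma rank_formula0 s k : rank_formula s k 0 = 1.
Proof. by []. Qed.

Lemma rank_formula_low s k i : (0 < i < s)%N -> rank_formula s k i = low (2 ^+ i).
Proof. by rewrite /rank_formula; case: i => // i /andP[_ ->]. Qed.

Lemma rank_formula_middle s k : (0 < s)%N ->
  rank_formula s k s = middle (2 ^+ s) (2 ^+ k).
Proof. by rewrite /rank_formula; case: s => // s _; rewrite ltnn eqxx. Qed.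

Lemma rank_formula_high s k i : (s < i < s + s)%N ->
  rank_formula s k i = high (2 ^+ s) (2 ^+ k) (2 ^+ i).
Proof.
move=> /andP[si i2]; rewrite /rank_formula i2; case: i si i2 => // i si _.
by rewrite ltnNge (ltnW si) /= gtn_eqF.
Qed.

Lemma rank_formula_full s k : (0 < s)%N ->
  rank_formula s k (s + s) = full (2 ^+ s) (2 ^+ k).
Proof.
move=> s0; rewrite /rank_formula ltnn; case: ifP => [|_]; first by lia.
case: ifP => [|_]; first by lia.
by case: ifP => //; lia.
Qed.

Lemma pow2_neq0 n : (2 : rat) ^+ n != 0.
Proof. by rewrite expf_neq0. Qed.

Lemma rank_formula_rec s k i : (0 < s)%N -> (i.+1 < k)%N -> (i < s + s)%N ->
  rank_formula s.+1 k i.+1 =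
  rank_formula s k.+1 i + rank_formula s i.+2 i.+1 - rank_formula s i.+1 i.
Proof.
move=> s0 ik i2s; have Zn0 := pow2_neq0 i; have Xn0 := pow2_neq0 s.
case: (ltngtP i s) => [lt_is | lt_si | e].
- rewrite rank_formula_low //.
  (* At the boundary [i.+1 = s], [middle] with [Y = 2 * X] takes the value [low X]. *)
  have -> : rank_formula s i.+2 i.+1 = low (2 ^+ i.+1).
    case: (ltngtP i.+1 s) => [lt|gt|e]; last 1 first.
    + rewrite -e rank_formula_middle // /middle /low 2!exprS.
      by field.
    + by rewrite rank_formula_low.
    + by lia.
  have [-> | i0] := posnP i; first by rewrite !rank_formula0 addrAC subrr add0r.
  by rewrite !rank_formula_low ?i0 // addrAC subrr add0r.
- rewrite rank_formula_high; last by lia.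
  rewrite !(@rank_formula_high s _ i); try by lia.
  (* At the boundary [i.+1 = s + s], [full] and [high] agree for [Y = 2 * X ^+ 2] and
     [Z = X ^+ 2]. *)
  have -> : rank_formula s i.+2 i.+1 = high (2 ^+ s) (2 ^+ i.+2) (2 ^+ i.+1).
    case: (ltnP i.+1 (s + s)) => [lt | ge].
      by rewrite rank_formula_high //; lia.
    have e : i.+1 = (s + s)%N by lia.
    rewrite e rank_formula_full // exprS exprD /full /high.
    by field.
  by rewrite /high !exprS; field.
- rewrite e rank_formula_middle // rank_formula_middle // rank_formula_middle //.
  (* For [s = 1] the rank [s.+1] is already full; the two formulas agree there. *)
  have -> : rank_formula s s.+2 s.+1 = high (2 ^+ s) (2 ^+ s.+2) (2 ^+ s.+1).
    have [s1|s1] := ltnP 1 s; first by rewrite rank_formula_high //; lia.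
    have -> : s = 1%N by lia.
    by rewrite /rank_formula /= /full /high; field.
  by rewrite /high /middle !exprS; field.
Qed.

(** * The two moments of the closed formula *)

Lemma sum_low m : \sum_(i < m.+1) (if i == 0%N :> nat then 1 else low (2 ^+ i))
  = 1 + 3 * ((2 ^+ m.+1) ^+ 3 - 8) / 16 - ((2 ^+ m.+1) ^+ 2 - 4) / 8.
Proof.
elim: m => [|m IHm]; first by rewrite big_ord1 /=; field.
by rewrite big_ord_recr IHm /= /low !exprS; field.
Qed.

Lemma sum_low_half m :
  \sum_(i < m.+1) (if i == 0%N :> nat then 1 else low (2 ^+ i)) / 2 ^+ i
  = 1 + 7 * ((2 ^+ m.+1) ^+ 2 - 4) / 16 - 3 * (2 ^+ m.+1 - 2) / 8.
Proof.
elim: m => [|m IHm]; first by rewrite big_ord1 /=; field.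
have Mn0 := pow2_neq0 m.
by rewrite big_ord_recr IHm /= /low !exprS; field.
Qed.

Lemma sum_high (X Y : rat) m0 m : X != 0 ->
  \sum_(i < m) high X Y (2 ^+ (m0 + i)) =
  21 * (Y / (16 * X ^+ 2) + 16^-1) * ((2 ^+ (m0 + m)) ^+ 3 - (2 ^+ m0) ^+ 3) / 7
  - 7 / (32 * X ^+ 2) * ((2 ^+ (m0 + m)) ^+ 4 - (2 ^+ m0) ^+ 4).
Proof.
move=> X0; elim: m => [|m IHm]; first by rewrite big_ord0 addn0 !subrr; field.
by rewrite big_ord_recr IHm /= addnS (exprS 2) /high; field.
Qed.

Lemma sum_high_half (X Y : rat) m0 m : X != 0 ->
  \sum_(i < m) high X Y (2 ^+ (m0 + i)) / 2 ^+ (m0 + i) =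
  7 * (Y / (16 * X ^+ 2) + 16^-1) * ((2 ^+ (m0 + m)) ^+ 2 - (2 ^+ m0) ^+ 2)
  - 15 / (32 * X ^+ 2) * ((2 ^+ (m0 + m)) ^+ 3 - (2 ^+ m0) ^+ 3).
Proof.
move=> X0; elim: m => [|m IHm]; first by rewrite big_ord0 addn0 !subrr; field.
have Mn0 := pow2_neq0 (m0 + m).
by rewrite big_ord_recr IHm /= addnS (exprS 2) /high; field; rewrite X0 Mn0.
Qed.

Lemma rank_formula_split (g : nat -> rat) s k :
  \sum_(i < (s.+1 + s.+1).+1) rank_formula s.+1 k i * g i =
  \sum_(i < s.+1) (if i == 0%N :> nat then 1 else low (2 ^+ i)) * g i
  + middle (2 ^+ s.+1) (2 ^+ k) * g s.+1
  + \sum_(i < s) high (2 ^+ s.+1) (2 ^+ k) (2 ^+ (s.+2 + i)) * g (s.+2 + i)%N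
  + full (2 ^+ s.+1) (2 ^+ k) * g (s.+1 + s.+1)%N.
Proof.
rewrite big_ord_recr /= rank_formula_full //; congr (_ + _).
rewrite -(big_mkord xpredT (fun i => rank_formula s.+1 k i * g i)).
rewrite addnS -addSn big_mkord big_split_ord /= big_ord_recr /=.
rewrite rank_formula_middle //; congr (_ + _ + _); apply: eq_bigr => i _.
  have [->|i0] := eqVneq (i : nat) 0%N; first by rewrite rank_formula0.
  by rewrite rank_formula_low // lt0n i0 ltn_ord.
by rewrite rank_formula_high //; have := ltn_ord i; lia.
Qed.

Lemma rank_formula_moment0 s k : (0 < s)%N ->
  \sum_(i < (s + s).+1) rank_formula s k i = (2 ^+ s) ^+ 2 * (2 ^+ k) ^+ 2 / 4.
Proof.
case: s => // s _; have X0 := pow2_neq0 s.+1.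
under eq_bigr do rewrite -[rank_formula _ _ _]mulr1.
rewrite (@rank_formula_split (fun=> 1)).
under eq_bigr do rewrite mulr1.
under [X in _ + X + _]eq_bigr do rewrite mulr1.
rewrite sum_low sum_high // [(s.+2 + s)%N]addSnnS exprD [2 ^+ s.+2]exprS.
by rewrite /middle /full; field.
Qed.

Lemma rank_formula_moment1 s k : (0 < s)%N ->
  \sum_(i < (s + s).+1) rank_formula s k i / 2 ^+ i =
  (2 ^+ s) ^+ 2 * 2 ^+ k / 4 + (2 ^+ k - 1) * 2 ^+ k / 4.
Proof.
case: s => // s _; have X0 := pow2_neq0 s.+1.
rewrite (@rank_formula_split (fun i => (2 ^+ i)^-1)).
rewrite sum_low_half sum_high_half // [(s.+2 + s)%N]addSnnS !exprD [2 ^+ s.+2]exprS.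
by rewrite /middle /full; field.
Qed.

Lemma natr_expn_half n m : (n.+1 = m)%N ->
  ((4 ^ n)%N)%:R = (2 ^+ m) ^+ 2 / 4 :> rat.
Proof.
by move=> <-; rewrite natrX -(exprM 2 n.+1 2) mulnC exprM exprS; field.
Qed.

(** The two moments give two independent linear equations for the two remaining counts. *)
Lemma rank_count_top n s k : (0 < s)%N -> (s + s <= k)%N -> (s + k = n.+1)%N ->
    (forall i, (i.+1 < s + s)%N -> (rank_count n s k i)%:R = rank_formula s k i) ->
  (rank_count n s k (s + s).-1)%:R = rank_formula s k (s + s).-1 /\
  (rank_count n s k (s + s))%:R = rank_formula s k (s + s).
Proof.
move=> s0 sk skn IH; have Y0 := pow2_neq0 k.
have m0 : \sum_(i < (s + s).+1) (rank_count n s k i)%:R =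
          \sum_(i < (s + s).+1) rank_formula s k i.
  rewrite -natr_sum rank_count_moment0 rank_formula_moment0 //.
  by rewrite (natr_expn_half (esym skn)) exprD exprMn.
have m1 : \sum_(i < (s + s).+1) (rank_count n s k i)%:R / 2 ^+ i =
          \sum_(i < (s + s).+1) rank_formula s k i / 2 ^+ i.
  (* Multiplication by [2 ^+ k] turns the weights [2 ^- i] into the kernel sizes [2 ^ (k - i)]; the
     subtraction is exact as [i <= s + s <= k]. *)
  apply: (mulIf Y0); rewrite rank_formula_moment1 // mulr_suml.
  transitivity ((\sum_(i < (s + s).+1) rank_count n s k i * 2 ^ (k - i))%N%:R : rat).
    rewrite natr_sum; apply: eq_bigr => i _; rewrite natrM natrX.
    have ik : (i <= k)%N by have := ltn_ord i; lia.
    have -> : (2 : rat) ^+ k = 2 ^+ (k - i) * 2 ^+ i by rewrite -exprD subnK.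
    by rewrite mulrAC mulrA mulfK ?pow2_neq0.
  rewrite rank_count_moment1 // natrD natrM natrB ?expn_gt0 //.
  have nk : ((n - s).+1 = k)%N by lia.
  rewrite (natr_expn_half (esym skn)) (natr_expn_half nk) natrX exprD exprMn.
  by field.
move: m0 m1; have e : (s + s = (s + s).-1.+1)%N by rewrite prednK // addn_gt0 s0.
set t := (s + s).-1 in e *; rewrite e !big_ord_recr /=.
have -> : \sum_(i < t) (rank_count n s k i)%:R = \sum_(i < t) rank_formula s k i.
  by apply: eq_bigr => i _; rewrite IH // e ltnS ltn_ord.
have -> : \sum_(i < t) (rank_count n s k i)%:R / 2 ^+ i
        = \sum_(i < t) rank_formula s k i / 2 ^+ i.
  by apply: eq_bigr => i _; rewrite IH // e ltnS ltn_ord.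
rewrite -!addrA => /addrI m0 /addrI m1.
have T0 := pow2_neq0 t.
(* Scaled by [2 ^+ t.+1], the two top terms get the weights 2 and 1, against 1 and 1 in [m0]. *)
have {}m1 : 2 * (rank_count n s k t)%:R + (rank_count n s k t.+1)%:R =
   2 * rank_formula s k t + rank_formula s k t.+1.
  apply: (mulIf (invr_neq0 (pow2_neq0 t.+1))).
  have half (x : rat) : 2 * x / 2 ^+ t.+1 = x / 2 ^+ t by rewrite exprS; field.
  by rewrite 2!(mulrDl (2 * _)) !half.
have solve (a b a' b' : rat) : a + b = a' + b' -> 2 * a + b = 2 * a' + b' -> a = a'.
  lra.
have x := solve _ _ _ _ m0 m1.
by split=> //; move: m0; rewrite x => /addrI.
Qed.

Lemma rank_countE s n k i : (0 < s)%N -> (i < k)%N -> (i <= s + s)%N ->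
  (s + k = n.+1)%N -> (rank_count n s k i)%:R = rank_formula s k i.
Proof.
elim: s n k i => // s IHs n k i _ ik i2s skn.
(* All ranks but the two largest come from the recursion. When [s.+1 = 1] this leaves only rank 0,
   so the induction needs no other base case. *)
have main j : (j.+1 < s.+1 + s.+1)%N -> (j < k)%N ->
    (rank_count n s.+1 k j)%:R = rank_formula s.+1 k j.
  case: j => [_ k0 | j j2s jk]; first by rewrite rank_count0 // rank_formula0.
  have s0 : (0 < s)%N by lia.
  have j2 : (j < s + s)%N by lia.
  have -> : n = (s + k)%N by lia.
  rewrite rank_formula_rec // -(IHs (s + k)%N k.+1 j) //; try by lia.
  rewrite -(IHs (s + j.+1)%N j.+2 j.+1) //; try by lia.
  rewrite -(IHs (s + j)%N j.+1 j) //; try by lia.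
  have := congr1 (fun m : nat => m%:R : rat) (rank_count_rec s0 jk j2).
  by rewrite /= !natrD => E; rewrite -E addrK.
have [lt|ge] := ltnP i.+1 (s.+1 + s.+1); first exact: main.
(* Here [i] is one of the two largest ranks, and [i < k] forces [s.+1 + s.+1 <= k]. *)
have [||top1 top2] := @rank_count_top n s.+1 k isT _ skn.
- by lia.
- by move=> j j2; apply: main => //; lia.
have [->|ne] := eqVneq i (s.+1 + s.+1)%N; first exact: top2.
by have -> : i = (s.+1 + s.+1).-1 by lia.
Qed.

(** Exponents such as [3 * i - 4] can be negative, so integer powers are turned into quotients of
    natural powers. *)
Lemma exp2z_sub (e : int) (a c : nat) : e = a%:Z - c%:Z ->
  (2 : rat) ^ e = 2 ^+ a / 2 ^+ c.
Proof. by move=> ->; rewrite expfzDr // exprnN. Qed.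

Theorem theorem2p9 (s k i : nat) (hs : (1 <= s)%N) :
  (i = 0%N -> (1 <= k)%N ->
     (Gamma i s k)%:R = 1 :> rat)
  /\
  ((1 <= i <= s - 1)%N -> (i < k)%N ->
     (Gamma i s k)%:R = 21 * 2 ^ (3 * i%:Z - 4) - 3 * 2 ^ (2 * i%:Z - 3) :> rat)
  /\
  (i = s -> (s < k)%N ->
     (Gamma i s k)%:R = 3 * 2 ^ (k%:Z + s%:Z - 1) + 21 * 2 ^ (3 * s%:Z - 4)
                        - 27 * 2 ^ (2 * s%:Z - 3) :> rat)
  /\
  ((s + 1 <= i <= 2 * s - 1)%N -> (i < k)%N ->
     (Gamma i s k)%:R = 21 * (2 ^ (k%:Z - 2 * s%:Z + 3 * i%:Z - 4)
                              + 2 ^ (3 * i%:Z - 4)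
                              - 5 * 2 ^ (4 * i%:Z - 2 * s%:Z - 5)) :> rat)
  /\
  (i = (2 * s)%N -> (2 * s < k)%N ->
     (Gamma i s k)%:R = 2 ^ (2 * k%:Z + 2 * s%:Z - 2)
                        - 3 * 2 ^ (k%:Z + 4 * s%:Z - 4)
                        + 2 ^ (6 * s%:Z - 5) :> rat).
Proof.
have GE : (i < k)%N -> (i <= s + s)%N -> (Gamma i s k)%:R = rank_formula s k i :> rat.
  move=> ik i2s; have skn : (s + k = (s + k).-1.+1)%N by lia.
  by rewrite (Gamma_rank_count i hs _ skn) ?rank_countE //; lia.
have exp_mulE (a b : nat) : (2 : rat) ^+ (a * b) = (2 ^+ b) ^+ a by rewrite mulnC exprM.
have X0 := pow2_neq0 s.
split=> [i0 k0|]; first by rewrite GE i0 //; lia.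
split=> [i1 ik|].
  rewrite GE ?rank_formula_low //; try by lia.
  rewrite (@exp2z_sub _ (3 * i) 4) 1?(@exp2z_sub _ (2 * i) 3); try by lia.
  by rewrite !exp_mulE /low; field.
split=> [is_ sk|].
  rewrite GE ?is_ ?rank_formula_middle //; try by lia.
  rewrite (@exp2z_sub _ (k + s) 1) 1?(@exp2z_sub _ (3 * s) 4)
    1?(@exp2z_sub _ (2 * s) 3); try by lia.
  by rewrite (exprD 2 k s) !exp_mulE /middle; field.
split=> [i1 ik|].
  rewrite GE ?rank_formula_high //; try by lia.
  rewrite (@exp2z_sub (k%:Z - _ + _ - _) (k + 3 * i) (2 * s + 4))
    1?(@exp2z_sub _ (3 * i) 4) 1?(@exp2z_sub _ (4 * i) (2 * s + 5)); try by lia.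
  by rewrite (exprD 2 k) !(exprD 2 (2 * s)) !exp_mulE /high; field.
move=> i2 sk; have e2 : (2 * s = s + s)%N by lia.
rewrite GE ?i2 ?e2 ?rank_formula_full //; try by lia.
rewrite (@exp2z_sub _ (2 * k + 2 * s) 2) 1?(@exp2z_sub _ (k + 4 * s) 4)
  1?(@exp2z_sub _ (6 * s) 5); try by lia.
by rewrite (exprD 2 (2 * k)) (exprD 2 k) !exp_mulE /full; field.
Qed.
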